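(* Let $\rho>0$ and, for each $x\in\mathsf X$, $t\in\{0,\dots,T\}$ and $h_x^t=(h_{x,1},\dots,h_{x,t})\in\mathcal H_x^t$, let $$\widehat W_{x,t}(h_x^t)=\rho\log\Big(\sum_{u\in\mathsf U}\exp\Big(-\frac1\rho\sum_{s=1}^th_{x,s}(u)\Big)\Big)+\frac2\rho(T-t)L(\mathsf X,\mathsf U,\mathcal F)^2 .$$ This relaxation is admissible (at every state $x\in\mathsf X$), and it leads to a recursive exponential weights algorithm, specified recursively as follows: for all $x\in\mathsf X$, $u\in\mathsf U$, $$P_{t+1}(u|x)=\frac{P_t(u|x)\exp\big(-\frac1\rho h_{x,t}(u)\big)}{\big\langle P_t(\cdot|x),\exp\big(-\frac1\rho h_{x,t}\big)\big\rangle}=\frac{\nu_1(u)\exp\big(-\frac1\rho\sum_{s=1}^th_{x,s}(u)\big)}{\big\langle\nu_1,\exp\big(-\frac1\rho\sum_{s=1}^th_{x,s}\big)\big\rangle},\qquad t=0,\dots,T-1,$$ where $\nu_1$ is the uniform distribution on $\mathsf U$ (for $t=0$ the formula is read as $P_1(\cdot|x)=\nu_1$).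
   Context: $\mathsf X,\mathsf U$ are finite sets (states, actions); $K(y|x,u)$ is a fixed transition kernel on $\mathsf X$ given $\mathsf X\times\mathsf U$; $\mathcal P(\mathsf U)$ is the set of probability distributions on $\mathsf U$; $\mathcal M(\mathsf U|\mathsf X)$ is the set of Markov matrices $P=[P(u|x)]$ with $P(\cdot|x)\in\mathcal P(\mathsf U)$; for every $P\in\mathcal M(\mathsf U|\mathsf X)$ the kernel $K(y|x,P)=\sum_uK(y|x,u)P(u|x)$ is assumed to have a unique invariant distribution $\pi_P$. $(\pi\otimes P)(x,u)=\pi(x)P(u|x)$; $\langle\nu,f\rangle$ is the expectation of $f$ under $\nu$; $\log$ is natural. $\mathcal F$ is a fixed class of functions $\mathsf X\times\mathsf U\to\mathbb R$; $T$ is a fixed finite horizon. $\widehat Q:\mathsf X\times\mathsf U\to\mathbb R$ satisfies the reverse Poisson inequality for $P$ with forcing function $g:\mathsf X\times\mathsf U\to\mathbb R$ if for all $(x,u)$ $$\sum_yK(y|x,u)\widehat Q(y,P)-\widehat Q(x,u)\ge -g(x,u)+\langle\pi_P\otimes P,g\rangle,\qquad \widehat Q(y,P)=\sum_{u'}P(u'|y)\widehat Q(y,u').$$ Standing assumption: for every $P\in\mathcal M(\mathsf U|\mathsf X)$ and $f\in\mathcal F$ there is a function $\widehat Q_{P,f}$ satisfying the reverse Poisson inequality for $P$ with forcing function $f$, and $L(\mathsf X,\mathsf U,\mathcal F)=\sup_{P\in\mathcal M(\mathsf U|\mathsf X)}\sup_{f\in\mathcal F}\|\widehat Q_{P,f}\|_\infty<\infty$.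 $\mathcal H_x$ is the class of functions $\mathsf U\to\mathbb R$ of the form $\widehat Q_{P,f}(x,\cdot)$ with $P\in\mathcal M(\mathsf U|\mathsf X)$, $f\in\mathcal F$. A sequence $\widehat W_{x,t}:\mathcal H_x^t\to\mathbb R$, $t=0,\dots,T$, is an admissible relaxation at state $x$ if for all $h_{x,1},\dots,h_{x,T}\in\mathcal H_x$ $$\widehat W_{x,T}(h_x^T)\ge-\inf_{\nu\in\mathcal P(\mathsf U)}\mathbb E_{U\sim\nu}\Big[\sum_{t=1}^Th_{x,t}(U)\Big],$$ $$\widehat W_{x,t}(h_x^t)\ge\inf_{\nu\in\mathcal P(\mathsf U)}\sup_{h_x\in\mathcal H_x}\big\{\mathbb E_{U\sim\nu}[h_x(U)]+\widehat W_{x,t+1}(h_x^t,h_x)\big\},\quad t=T-1,\dots,0.$$ The algorithm (behavioral strategy) associated to an admissible relaxation, when the environment reveals cost functions $f_1,f_2,\dots\in\mathcal F$ one at a time, is $$P_t(\cdot|x)=\operatorname*{arg\,min}_{\nu\in\mathcal P(\mathsf U)}\sup_{h_x\in\mathcal H_x}\big\{\mathbb E_{U\sim\nu}[h_x(U)]+\widehat W_{x,t}(h_x^{t-1},h_x)\big\},\qquad h_{y,t}=\widehat Q_{P_t,f_t}(y,\cdot)\ \ \forall y\in\mathsf X;$$ at time $t$ in state $x$ the agent draws its action from $P_t(\cdot|x)$.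
   Formalization: ''Leads to'' is read as: each P_{t+1}(.|x) keeps the sup in the recursive admissibility condition at most W_{x,t}, not as being its exact arg min; the literal arg min claim is false, e.g. when H_x consists of one nonconstant function. *)

(* Defs.v *)
From HB Require Import structures.
From mathcomp Require Import all_boot all_order all_algebra.
From mathcomp Require Import boolp classical_sets constructive_ereal reals ereal.
From mathcomp Require Import sequences exp.

Set Implicit Arguments.
Unset Strict Implicit.
Unset Printing Implicit Defensive.

Import Order.TTheory GRing.Theory Num.Theory.

Local Open Scope classical_set_scope.
Local Open Scope ring_scope.

Section FiniteDistributions.
Context {R : realType} {A : finType}.

Definition distributions : set (A -> R) :=
  [set nu | (forall a, 0 <= nu a) /\ \sum_a nu a = 1].

Definition expectation (nu g : A -> R) : R := \sum_a nu a * g a.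

Definition uniform : A -> R := fun=> (#|A|%:R)^-1.

End FiniteDistributions.
Arguments distributions R A : clear implicits.
Arguments uniform R A : clear implicits.

Section ControlledChain.
Context {R : realType} {X U : finType}.

(* [K x u y] stands for K(y|x,u) and [P x u] for P(u|x). *)
Implicit Types (K : X -> U -> X -> R) (P : X -> U -> R).

Definition markov_matrices : set (X -> U -> R) :=
  [set P | forall x, distributions R U (P x)].

Definition transition_kernel K : Prop :=
  forall x u, distributions R X (K x u).

Definition induced_kernel K P (x y : X) : R := \sum_u K x u y * P x u.

Definition invariant_distributions K P : set (X -> R) :=
  [set p | distributions R X p /\
           forall y, \sum_x p x * induced_kernel K P x y = p y].

Definition unique_invariant K (pi : (X -> U -> R) -> X -> R) : Prop :=
  forall P, markov_matrices P -> invariant_distributions K P = [set pi P].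

Definition joint (p : X -> R) P : X * U -> R := fun z => p z.1 * P z.1 z.2.

Definition reverse_poisson K (p : X -> R) P (g Q : X -> U -> R) : Prop :=
  forall x u,
    - g x u + expectation (joint p P) (fun z => g z.1 z.2)
    <= \sum_y K x u y * expectation (P y) (Q y) - Q x u.

Definition sup_norm (Q : X -> U -> R) : R :=
  \big[Num.max/0]_(z : X * U) `|Q z.1 z.2|.

(* In what follows [Q P f] is the selected solution of the reverse Poisson
   inequality for P with forcing function f. *)
Implicit Types (F : set (X -> U -> R))
  (Q : (X -> U -> R) -> (X -> U -> R) -> X -> U -> R).

Definition sup_norm_bound F Q : \bar R :=
  ereal_sup [set (sup_norm (Q P f))%:E | P in markov_matrices & f in F].

Definition local_class F Q (x : X) : set (U -> R) :=
  [set Q P f x | P in markov_matrices & f in F].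

(* h_x^t along a run in which P_1, P_2, ... are played against f_1, f_2, ...;
   the values of [P] and [f] at 0 are unused. *)
Definition run_history Q (P f : nat -> X -> U -> R) (x : X) (t : nat)
    : t.-tuple (U -> R) :=
  [tuple Q (P s.+1) (f s.+1) x | s < t].

End ControlledChain.
Arguments markov_matrices R X U : clear implicits.

Section Relaxations.
Context {R : realType} {U : finType}.

Definition relaxation := forall t : nat, t.-tuple (U -> R) -> R.

Definition history_in (H : set (U -> R)) (t : nat) (h : t.-tuple (U -> R)) :=
  forall s, H (tnth h s).

Definition total_cost (t : nat) (h : t.-tuple (U -> R)) (u : U) : R :=
  \sum_(s < t) tnth h s u.

(* Worst-case value of playing [nu] in the round following the history [h]. *)
Definition round_value (H : set (U -> R)) (W : relaxation) (t : nat)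
    (h : t.-tuple (U -> R)) (nu : U -> R) : \bar R :=
  ereal_sup [set (expectation nu g + W t.+1 [tuple of rcons h g])%:E | g in H].

Definition admissible (T : nat) (H : set (U -> R)) (W : relaxation) : Prop :=
  (forall h : T.-tuple (U -> R), history_in H h ->
     (- ereal_inf [set (expectation nu (total_cost h))%:E
                    | nu in distributions R U] <= (W T h)%:E)%E)
  /\
  (forall t (h : t.-tuple (U -> R)), (t < T)%N -> history_in H h ->
     (ereal_inf [set round_value H W h nu | nu in distributions R U]
      <= (W t h)%:E)%E).

Definition exp_weights_relaxation (T : nat) (rho L : R) : relaxation :=
  fun t h =>
    rho * ln (\sum_u expR (- rho^-1 * total_cost h u))
    + 2 / rho * (T - t)%:R * L ^+ 2.

End Relaxations.
Arguments relaxation R U : clear implicits.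

(* A strategy obtained from the relaxations [W x]: at every state and round the
   distribution played is a witness of the recursive admissibility inequality,
   that is, it keeps the worst case of the minimax objective below W_{x,t}.
   Exact minimizers of [round_value] are witnesses whenever [W x] is admissible,
   but exponential weights need not be exact minimizers: if the local class is
   {g} with g nonconstant, only distributions supported on the minimizers of g
   minimize [round_value], whatever the history. *)
Definition relaxation_strategy {R : realType} {X U : finType} (T : nat)
    (F : set (X -> U -> R))
    (Q : (X -> U -> R) -> (X -> U -> R) -> X -> U -> R)
    (W : X -> relaxation R U) (f P : nat -> X -> U -> R) : Prop :=
  forall t x, (t < T)%N ->
    distributions R U (P t.+1 x) /\
    (round_value (local_class F Q x) (W x) (run_history Q P f x t) (P t.+1 x)
     <= (W x t (run_history Q P f x t))%:E)%E.

(* Main.v *)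
(** For weights [P ~ expR (- S / rho)] the partition function [Z] satisfies
    [Z(S + g) = Z(S) * E_P[expR (- g / rho)]], so the one-step admissibility
    inequality is a bound on the log-moment generating function of a cost with
    values in [-L, L]: [E[expR y] <= expR (E[y] + 2 c^2)] whenever [|y| <= c].
    The factor 2 (Hoeffding's lemma has 1/2) leaves room for an elementary
    proof: if [c > 1], then [c <= - c + 2 c^2]; if [c <= 1], integrate
    [expR y <= 1 + y + 2 y^2]. *)
Require Import Defs.
From HB Require Import structures.
From mathcomp Require Import all_boot all_order all_algebra.
From mathcomp Require Import boolp classical_sets constructive_ereal reals ereal.
From mathcomp Require Import sequences exp.
From mathcomp Require Import ring lra.

Set Implicit Arguments.
Unset Strict Implicit.
Unset Printing Implicit Defensive.

Import Order.TTheory GRing.Theory Num.Theory.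

Local Open Scope classical_set_scope.
Local Open Scope ring_scope.

Lemma expR_le_quadratic (R : realType) (y : R) :
  `|y| <= 1 -> expR y <= 1 + y + 2 * y ^+ 2.
Proof.
rewrite ler_norml => /andP[yge yle].
(* [expR (- y / 2) >= 1 - y / 2], so [expR y <= (1 - y / 2)^-2]. *)
have e1 : 1 - y / 2 <= expR (- (y / 2)) by rewrite expR_ge1Dx.
have e2 : (1 - y / 2) ^+ 2 <= expR (- y).
  have -> : - y = - (y / 2) + - (y / 2) by field.
  rewrite expRD -expr2 lerXn2r// nnegrE ?expR_ge0//; lra.
have q0 : 0 <= 1 + y + 2 * y ^+ 2 by nra.
have e3 : 1 <= (1 + y + 2 * y ^+ 2) * expR (- y).
  apply: le_trans (ler_wpM2l q0 e2).
  (* The excess over 1 is [y ^+ 2] times a quadratic with roots 1 and 5/2, hence nonnegative for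
     [y <= 1]. *)
  have -> : (1 + y + 2 * y ^+ 2) * (1 - y / 2) ^+ 2
    = 1 + y ^+ 2 * ((1 - y) * (5 - 2 * y) / 4) by field.
  rewrite lerDl mulr_ge0 ?sqr_ge0// divr_ge0// mulr_ge0//; lra.
by move: e3; rewrite expRN ler_pdivlMr ?expR_gt0// mul1r.
Qed.

Section Expectation.
Context {R : realType} {A : finType}.
Implicit Types (nu g h : A -> R) (c : R).

Lemma expectation_cst nu c :
  distributions R A nu -> expectation nu (fun=> c) = c.
Proof. by case=> _ nu1; rewrite /expectation -mulr_suml nu1 mul1r. Qed.

Lemma expectationD nu g h :
  expectation nu (fun a => g a + h a) = expectation nu g + expectation nu h.
Proof. by rewrite -big_split; apply: eq_bigr => a _; rewrite mulrDr. Qed.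

Lemma expectationZ nu c g :
  expectation nu (fun a => c * g a) = c * expectation nu g.
Proof. by rewrite mulr_sumr; apply: eq_bigr => a _; rewrite mulrCA. Qed.

Lemma le_expectation nu g h : distributions R A nu ->
  (forall a, g a <= h a) -> expectation nu g <= expectation nu h.
Proof. by case=> nu0 _ gh; apply: ler_sum => a _; rewrite ler_wpM2l. Qed.

Lemma expectation_expR_le nu g c : distributions R A nu ->
  (forall a, `|g a| <= c) ->
  expectation nu (fun a => expR (g a)) <= expR (expectation nu g + 2 * c ^+ 2).
Proof.
move=> nuD gc.
have [c1|c1] := leP c 1; last first.
  apply: (@le_trans _ _ (expR c)).
    rewrite -(expectation_cst (expR c) nuD); apply: le_expectation => // a.
    by rewrite ler_expR (le_trans (ler_norm _)).
  have : - c <= expectation nu g.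
    rewrite -(expectation_cst (- c) nuD); apply: le_expectation => // a.
    by have := gc a; rewrite ler_norml => /andP[].
  by rewrite ler_expR => ?; nra.
(* Since [1 + z <= expR z], a bound affine in the mean suffices. Its constants are then written as
   expectations, so the comparison becomes pointwise. *)
apply: le_trans (expR_ge1Dx _).
rewrite addrA -{1}(expectation_cst 1 nuD) -(expectation_cst (2 * c ^+ 2) nuD).
rewrite -!expectationD; apply: le_expectation => // a.
apply: le_trans (expR_le_quadratic (le_trans (gc a) c1)) _.
rewrite lerD2l ler_pM2l// -real_normK ?num_real// lerXn2r// nnegrE//.
exact: le_trans (gc a).
Qed.

End Expectation.

Section Gibbs.
Context {R : realType} {U : finType}.
Hypothesis U_gt0 : (0 < #|U|)%N.
Implicit Types (rho c L : R) (S g nu : U -> R).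

Definition partition_function rho S : R := \sum_u expR (- rho^-1 * S u).

Definition gibbs rho S (u : U) : R :=
  expR (- rho^-1 * S u) / partition_function rho S.

Lemma partition_function_gt0 rho S : 0 < partition_function rho S.
Proof.
have /card_gt0P[u0 _] := U_gt0.
rewrite /partition_function (bigD1 u0)//= ltr_wpDr ?expR_gt0//.
by rewrite sumr_ge0// => u _; rewrite expR_ge0.
Qed.

Lemma gibbs_distribution rho S : distributions R U (gibbs rho S).
Proof.
split=> [u|]; first by rewrite divr_ge0 ?expR_ge0 ?ltW ?partition_function_gt0.
by rewrite -mulr_suml divff// gt_eqF ?partition_function_gt0.
Qed.

Lemma expectation_gibbs rho S g : expectation (gibbs rho S) g =
  (\sum_u expR (- rho^-1 * S u) * g u) / partition_function rho S.
Proof. by rewrite mulr_suml; apply: eq_bigr => u _; rewrite mulrAC. Qed.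

Lemma partition_functionD rho S g :
  partition_function rho (fun u => S u + g u) = partition_function rho S *
    expectation (gibbs rho S) (fun u => expR (- rho^-1 * g u)).
Proof.
rewrite expectation_gibbs mulrC divfK ?gt_eqF ?partition_function_gt0//.
by apply: eq_bigr => u _; rewrite mulrDr expRD.
Qed.

Lemma gibbsD rho S g u : gibbs rho (fun u => S u + g u) u =
  gibbs rho S u * expR (- rho^-1 * g u)
    / expectation (gibbs rho S) (fun v => expR (- rho^-1 * g v)).
Proof.
rewrite {1}/gibbs partition_functionD mulrDr expRD invfM mulrA.
by rewrite [in RHS]/gibbs; congr (_ / _); rewrite mulrAC.
Qed.

Lemma gibbs0 rho : gibbs rho (fun=> 0) = uniform R U.
Proof.
apply/funext => u.
by rewrite /gibbs /partition_function mulr0 expR0 sumr_const mul1r.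
Qed.

(** The closed form is a single update [gibbsD] that starts from zero cost, with all of [S] as the
    increment. *)
Lemma gibbs_uniform rho S u : gibbs rho S u =
  uniform R U u * expR (- rho^-1 * S u)
    / expectation (uniform R U) (fun v => expR (- rho^-1 * S v)).
Proof.
rewrite -(gibbs0 rho) -gibbsD; congr (gibbs rho _ u).
by apply/funext => v; rewrite add0r.
Qed.

(** A sum of exponentials dominates each of its terms, so the right side is at least [- S u] for
    every [u]; then average under [nu]. *)
Lemma expectation_opp_le_free_energy rho S nu : 0 < rho ->
  distributions R U nu ->
  - expectation nu S <= rho * ln (partition_function rho S).
Proof.
move=> rho0 nuD; rewrite -mulN1r -expectationZ -(expectation_cst (rho * _) nuD).
apply: le_expectation => // u.
rewrite mulN1r -ler_pdivrMl// mulrN -mulNr -[leLHS]expRK.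
rewrite ler_ln ?posrE ?expR_gt0 ?partition_function_gt0//.
rewrite /partition_function (bigD1 u)//= lerDl.
by rewrite sumr_ge0// => v _; rewrite expR_ge0.
Qed.

(** The free energy changes by [rho] times the log-moment generating function of [- g / rho], whose
    values are at most [L / rho] in size. The mean of [g] cancels, and [rho * 2 * (L / rho) ^+ 2]
    remains. *)
Lemma free_energyD_le rho L S g : 0 < rho -> (forall u, `|g u| <= L) ->
  expectation (gibbs rho S) g
    + rho * ln (partition_function rho (fun u => S u + g u))
  <= rho * ln (partition_function rho S) + 2 / rho * L ^+ 2.
Proof.
move=> rho0 gL; have rhoN0 : rho != 0 by rewrite gt_eqF.
have gD := gibbs_distribution rho S.
(* This is a ratio of two partition functions. *)
have E0 : 0 < expectation (gibbs rho S) (fun u => expR (- rho^-1 * g u)).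
  rewrite -(pmulr_rgt0 _ (partition_function_gt0 rho S)) -partition_functionD.
  exact: partition_function_gt0.
have bnd u : `|- rho^-1 * g u| <= rho^-1 * L.
  by rewrite normrM normrN (gtr0_norm (_ : 0 < rho^-1)) ?ler_pM2l ?invr_gt0.
have := expectation_expR_le gD bnd.
rewrite -ler_ln ?posrE ?expR_gt0// expRK expectationZ -(ler_pM2l rho0).
rewrite partition_functionD lnM ?posrE ?partition_function_gt0//.
have -> : forall e, rho * (- rho^-1 * e + 2 * (rho^-1 * L) ^+ 2)
    = - e + 2 / rho * L ^+ 2 by move=> e; field.
lra.
Qed.

Lemma total_cost_rcons t (h : t.-tuple (U -> R)) g u :
  total_cost [tuple of rcons h g] u = total_cost h u + g u.
Proof.
rewrite /total_cost big_ord_recr/=; congr (_ + _).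
  apply: eq_bigr => s _; rewrite !(tnth_nth g)/= nth_rcons size_tuple.
  by rewrite ltn_ord.
by rewrite (tnth_nth g)/= nth_rcons size_tuple ltnn eqxx.
Qed.

Lemma gibbs_round_value_le (T : nat) rho L (H : set (U -> R)) t
    (h : t.-tuple (U -> R)) :
  0 < rho -> (forall g, H g -> forall u, `|g u| <= L) -> (t < T)%N ->
  (round_value H (exp_weights_relaxation T rho L) h (gibbs rho (total_cost h))
   <= (exp_weights_relaxation T rho L h)%:E)%E.
Proof.
move=> rho0 HL tT; apply: ge_ereal_sup => _ [g Hg <-].
have := free_energyD_le (total_cost h) rho0 (HL g Hg).
rewrite lee_fin /exp_weights_relaxation.
under [X in _ <= _ -> _ + (_ * ln X + _) <= _]eq_bigr
  do rewrite total_cost_rcons.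
(* One of the [T - t] reserved terms [2 / rho * L ^+ 2] is released to pay for this round. *)
rewrite -(subnSK tT) -[(T - t.+1).+1]addn1 natrD mulrDr mulrDl mulr1.
rewrite /partition_function.
lra.
Qed.

Lemma exp_weights_admissible (T : nat) rho L (H : set (U -> R)) :
  0 < rho -> (forall g, H g -> forall u, `|g u| <= L) ->
  admissible T H (exp_weights_relaxation T rho L).
Proof.
move=> rho0 HL; split=> [h _|t h tT _].
  rewrite leeNl; apply: le_ereal_inf_tmp => _ [nu nuD <-].
  rewrite -EFinN lee_fin lerNl /exp_weights_relaxation subnn mulr0 mul0r addr0.
  exact: expectation_opp_le_free_energy.
(* The Gibbs distribution of the past costs bounds the infimum. *)
apply: le_trans (gibbs_round_value_le h rho0 HL tT).
by apply: ereal_inf_lbound; exists (gibbs rho (total_cost h)) => //;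
  exact: gibbs_distribution.
Qed.

End Gibbs.

Lemma local_class_bounded (R : realType) (X U : finType)
    (F : set (X -> U -> R)) Q x (g : U -> R) :
  (sup_norm_bound F Q < +oo)%E -> local_class F Q x g ->
  forall u, `|g u| <= fine (sup_norm_bound F Q).
Proof.
move=> Lfin [P PM [f Ff <-]] u.
have sL : ((sup_norm (Q P f))%:E <= sup_norm_bound F Q)%E.
  by apply: ereal_sup_ubound; exists P => //; exists f.
(* [fine] sends infinities to 0. The member [Q P f] rules out the value -oo of an empty supremum. *)
have Lnum : sup_norm_bound F Q \is a fin_num.
  by rewrite fin_numElt Lfin (lt_le_trans (ltNyr _) sL).
apply: (@le_trans _ _ (sup_norm (Q P f))); last by rewrite -lee_fin fineK.
exact: (le_bigmax _ (fun z : X * U => `|Q P f z.1 z.2|) (x, u)).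
Qed.

Section Run.
Context {R : realType} {X U : finType}.
Variables (rho : R) (f : nat -> X -> U -> R).
Variable Q : (X -> U -> R) -> (X -> U -> R) -> X -> U -> R.

(** Strategy and costs determine each other: the cost of a round at [x] depends on the strategy of
    that round at all states. Recursion on the summed cost alone, with the strategy inlined as its
    Gibbs distribution, unties this. *)
Fixpoint cumulative_cost (t : nat) (x : X) (u : U) : R :=
  if t is s.+1 then
    cumulative_cost s x u
      + Q (fun y => gibbs rho (cumulative_cost s y)) (f s.+1) x u
  else 0.

(* [P_t] weighs the costs of rounds [1, ..., t - 1]; the value at [0] is junk. *)
Definition exp_weights (t : nat) (x : X) : U -> R :=
  gibbs rho (cumulative_cost t.-1 x).

Lemma cumulative_costE t x u :
  cumulative_cost t x u = \sum_(1 <= s < t.+1) Q (exp_weights s) (f s) x u.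
Proof.
elim: t => [|t IHt] /=; first by rewrite big_geq.
by rewrite big_nat_recr//= -IHt.
Qed.

Lemma total_cost_run t x :
  total_cost (run_history Q exp_weights f x t) = cumulative_cost t x.
Proof.
apply/funext => u; rewrite cumulative_costE big_add1 big_mkord.
by apply: eq_bigr => s _; rewrite tnth_mktuple.
Qed.

End Run.

Theorem proposition3 (R : realType) (X U : finType) (U_gt0 : (0 < #|U|)%N)
    (K : X -> U -> X -> R) (K_kernel : transition_kernel K)
    (pi : (X -> U -> R) -> X -> R) (pi_inv : unique_invariant K pi)
    (F : set (X -> U -> R)) (T : nat)
    (Q : (X -> U -> R) -> (X -> U -> R) -> X -> U -> R)
    (Q_poisson : forall P f, markov_matrices R X U P -> F f ->
       reverse_poisson K (pi P) P f (Q P f))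
    (L_fin : (sup_norm_bound F Q < +oo)%E)
    (rho : R) (rho_gt0 : 0 < rho) :
  let L := fine (sup_norm_bound F Q) in
  let W := exp_weights_relaxation T rho L in
  (forall x : X, admissible T (local_class F Q x) W) /\
  (forall f : nat -> X -> U -> R,
     (forall t, (0 < t <= T)%N -> F (f t)) ->
     exists P : nat -> X -> U -> R,
       let h x t u := Q (P t) (f t) x u in
       [/\ relaxation_strategy T F Q (fun=> W) f P,
           forall x, P 1%N x = uniform R U,
           forall t x u, (0 < t < T)%N ->
             P t.+1 x u = P t x u * expR (- rho^-1 * h x t u)
               / expectation (P t x) (fun v => expR (- rho^-1 * h x t v)) &
           forall t x u, (t < T)%N ->
             P t.+1 x u =
               uniform R U u * expR (- rho^-1 * \sum_(1 <= s < t.+1) h x s u)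
               / expectation (uniform R U)
                   (fun v => expR (- rho^-1 * \sum_(1 <= s < t.+1) h x s v))]).
Proof.
move=> L W; have HL x g := @local_class_bounded R X U F Q x g L_fin.
split=> [x|f _]; first exact: exp_weights_admissible (HL x).
exists (exp_weights rho f Q) => h; split=> [t x tT|x|[//|t] x u _|t x u _].
- split; first exact: gibbs_distribution.
  rewrite /exp_weights -[cumulative_cost _ _ _ t.+1.-1 x]total_cost_run.
  exact: (gibbs_round_value_le _ _ _ (HL x)).
- exact: gibbs0.
(* By conversion, the cumulative cost at a successor is the previous one plus the cost of the new
   round. *)
- exact: gibbsD.
- rewrite /exp_weights gibbs_uniform //= cumulative_costE.
  congr (_ / expectation _ _).
  by apply/funext => v; rewrite cumulative_costE.
Qed.
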